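(* Let $H$ be a graph with an edge $\{u,v\}$ such that $u$ and $v$ have no common neighbor, and let $G$ be the graph obtained from $H$ by contracting $\{u,v\}$ into a new vertex $w$. Let $i\in V(G)$ and suppose $A\in\mathcal{S}(G)$ has the $i$-SNIP. Then there is a matrix $A'\in\mathcal{S}(H)$ such that the $i$-nullity pair of $A'$ equals the $i$-nullity pair of $A$ and $A'$ has the $i$-SNIP; here, if $i\ne w$ then $i$ is the same vertex in $H$, and if $i=w$ then the root $i$ in $H$ can be designated as either $u$ or $v$.
   Context: All matrices are real. Contracting an edge identifies its endpoints and removes loops and multiple edges; vertices of $G$ other than $w$ are identified with the vertices of $H$ other than $u,v$. For a simple graph $G$ with vertices indexed by $[n]$, $\mathcal{S}(G)$ is the set of real symmetric $n\times n$ matrices whose off-diagonal $(j,k)$ entry is nonzero iff $\{j,k\}\in E(G)$ (diagonal free). $A(i)$ is $A$ with row and column $i$ deleted; the $i$-nullity pair of $A$ is $(\operatorname{null}(A),\operatorname{null}(A(i)))$. $A$ has the $i$-SNIP if $X=O$ is the only real symmetric $X$ with $A\circ X=O$, $I\circ X=O$ and $(AX)(i,:]=O$ ($AX$ with row $i$ deleted). *)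

(* Defs.v *)
From HB Require Import structures.
From mathcomp Require Import all_boot all_order all_algebra.
From mathcomp Require Import reals.
Set Implicit Arguments. Unset Strict Implicit. Unset Printing Implicit Defensive.
Import GRing.Theory.
Local Open Scope ring_scope.

Record sgraph (n : nat) := SGraph {
  edge : rel 'I_n;
  edge_sym : symmetric edge;
  edge_irrefl : irreflexive edge }.

(* phi : V(H) -> V(G) is the quotient map. Its only identification is that of
   u with v; away from the fibre over w it is the bijection through which
   V(G) \ {w} and V(H) \ {u, v} are identified. *)
Record is_contraction (m n : nat) (H : sgraph m) (u v : 'I_m)
    (G : sgraph n) (w : 'I_n) (phi : 'I_m -> 'I_n) : Prop := IsContraction {
  contr_edge : edge H u v;
  contr_onto : forall a : 'I_n, exists x : 'I_m, phi x = a;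
  contr_u : phi u = w;
  contr_v : phi v = w;
  contr_fibre_w : forall x : 'I_m, phi x = w -> x = u \/ x = v;
  contr_inj : forall x y : 'I_m, phi x <> w -> phi x = phi y -> x = y;
  contr_adj : forall a b : 'I_n,
    edge G a b <->
    a <> b /\ exists x y : 'I_m, [/\ phi x = a, phi y = b & edge H x y] }.

Definition symmetric_mx (R : realType) (n : nat) (A : 'M[R]_n) : Prop :=
  A^T = A.

Definition in_S (R : realType) (n : nat) (G : sgraph n) (A : 'M[R]_n) : Prop :=
  symmetric_mx A /\
  forall j k : 'I_n, j <> k -> (A j k <> 0 <-> edge G j k).

(* The columns of cokermx A span the null space {x | A *m x = 0}. *)
Definition nullity (R : realType) (n : nat) (A : 'M[R]_n) : nat :=
  \rank (cokermx A).

Definition principal_del (R : realType) (n : nat) (i : 'I_n) (A : 'M[R]_n) :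
  'M[R]_n.-1 := row' i (col' i A).

Definition nullity_pair (R : realType) (n : nat) (i : 'I_n) (A : 'M[R]_n) :
  nat * nat := (nullity A, nullity (principal_del i A)).

Definition hadamard (R : realType) (n : nat) (A B : 'M[R]_n) : 'M[R]_n :=
  \matrix_(j, k) (A j k * B j k).

Definition SNIP (R : realType) (n : nat) (i : 'I_n) (A : 'M[R]_n) : Prop :=
  forall X : 'M[R]_n,
    symmetric_mx X -> hadamard A X = 0 -> hadamard 1%:M X = 0 ->
    row' i (A *m X) = 0 -> X = 0.

(* Main.v *)
From HB Require Import structures.
From mathcomp Require Import all_boot all_order all_algebra.
From mathcomp Require Import boolp classical_sets functions reals.
From mathcomp Require Import interval_inference topology normedtype sequences.
From mathcomp Require Import ring lra.
Require Import Defs.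
Set Implicit Arguments.
Unset Strict Implicit.
Unset Printing Implicit Defensive.
Import Order.TTheory GRing.Theory Num.Theory.
Import numFieldNormedType.Exports.
Local Open Scope classical_set_scope.
Local Open Scope ring_scope.

(** Splitting [w] into [u] and [v] with a huge weight [1 / s] on
    [(x_u - x_v)^2] turns a matrix [C] of S(G) into a matrix [A'] of S(H);
    completing the square in [x_u] shows that [A'] is congruent to
    [B (+) (1 / s)] with [B = C - s c^T c], where [c] is the part of row [w] of
    [C] carried by the neighbours of [u].  So it remains to choose [C] near [A]
    with [B = (1 + K)^T A (1 + K)] and row [i] of [K] zero, since such
    congruences preserve both nullities.

    The SNIP says that S(G) and the orbit of [A] under these congruences meet
    transversally at [A].  Quantitatively, with [R] the matrix [A] without its
    row [i] and [S o X] the part of [X] on the diagonal and the edges of [G],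
    the operator [X |-> R^T R X + X R^T R + S o X + X - X^T] is injective:
    its quadratic form is a sum of squares vanishing exactly where the SNIP
    applies.  The equation for [K] and [C = A - S o X] is a small perturbation
    of this invertible linear operator, hence solvable by a fixed point
    argument.  The same inverse bounds every symmetric [Y] that could violate
    the SNIP of [A'] by a small multiple of its own norm. *)

Lemma col'_row' (R : Type) m n (i : 'I_m) (j : 'I_n) (X : 'M[R]_(m, n)) :
  col' j (row' i X) = row' i (col' j X).
Proof. by apply/matrixP => k l; rewrite !mxE. Qed.

Lemma row'_eq0P (R : nmodType) m n (i : 'I_m) (X : 'M[R]_(m, n)) :
  row' i X = 0 <-> forall x, x != i -> row x X = 0.
Proof.
split=> [X0 x xi|X0].
  case: (unliftP i x) xi => [y -> _|->]; last by rewrite eqxx.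
  by apply/rowP => l; have /matrixP/(_ y l) := X0; rewrite !mxE.
apply/matrixP => y l; have := X0 (lift i y); rewrite eq_sym neq_lift.
by move=> /(_ isT)/rowP/(_ l); rewrite !mxE.
Qed.

Section SubmatrixProduct.
Variable R : pzSemiRingType.

Lemma row'_mul m n p (i : 'I_m) (A : 'M[R]_(m, n)) (X : 'M[R]_(n, p)) :
  row' i (A *m X) = row' i A *m X.
Proof. by rewrite !row'Esub mul_rowsub_mx. Qed.

Lemma row'_col'_mul m n p (a : 'I_m) (i : 'I_n) (b : 'I_p)
    (L : 'M[R]_(m, n)) (M : 'M[R]_(n, p)) :
  row i (col' b M) = 0 ->
  row' a (col' b (L *m M)) = row' a (col' i L) *m row' i (col' b M).
Proof.
move=> Mi; apply/matrixP => k l; rewrite !mxE (bigD1_ord i) //=.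
have /rowP/(_ l) := Mi; rewrite !mxE => ->; rewrite mulr0 add0r.
by apply: eq_bigr => c _; rewrite !mxE.
Qed.

Lemma row_col'_delta m n (i : 'I_m) (j : 'I_n) (L : 'M[R]_(m, n)) :
  row i L = delta_mx 0 j -> row i (col' j L) = 0.
Proof.
move=> /rowP Li; apply/rowP => l; have := Li (lift j l).
by rewrite !mxE eq_sym (negPf (neq_lift _ _)) andbF.
Qed.

Lemma row'_col'1 n (i : 'I_n) : row' i (col' i 1%:M) = 1%:M :> 'M[R]_n.-1.
Proof. by apply/matrixP => a b; rewrite !mxE (inj_eq lift_inj). Qed.

End SubmatrixProduct.

Lemma nbhs_right0_mul_lt (R : realFieldType) (c e : R) :
  0 < e -> \forall s \near 0^'+, s * c < e.
Proof.
move=> e_gt0; near=> s.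
have s_gt0 : 0 < s by [].
have d_gt0 : 0 < `|c| + 1 by rewrite ltr_wpDl.
apply: (@le_lt_trans _ _ (s * (`|c| + 1))).
  by rewrite ler_wpM2l ?(ltW s_gt0) // (le_trans (ler_norm c)) // lerDl.
by rewrite -ltr_pdivlMr //; near: s; apply: nbhs_right_lt; rewrite divr_gt0.
Unshelve. all: by end_near. Qed.

Definition closed_ball0 (R : numDomainType) (V : normedZmodType R) (r : R) :
  set V := [set x | `|x| <= r].
Arguments closed_ball0 {R} V r.

Section PerturbedRoot.
Variables (R : realType) (V : completeNormedModType R).

Lemma closed_ball0_closed (r : R) : closed (closed_ball0 V r).
Proof.
have -> : closed_ball0 V r = closed_ball_ (@Num.norm _ V) 0 r.
  by apply/funext => x; rewrite /closed_ball0 /closed_ball_ /= sub0r normrN.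
exact: closed_closed_ball_.
Qed.

Lemma lipschitz_fixed_point (r q : R) (f : V -> V) :
  0 <= q < 1 -> `|f 0| <= (1 - q) * r -> q.-lipschitz_(closed_ball0 V r) f ->
  exists2 x, `|x| <= r & f x = x.
Proof.
move=> /andP[q_ge0 q_lt1] f0 flip.
have r_ge0 : 0 <= r.
  by have := le_trans (normr_ge0 _) f0; rewrite pmulr_rge0 ?subr_gt0.
have ball0 : closed_ball0 V r 0 by rewrite /closed_ball0 /= normr0.
have fB : set_fun (closed_ball0 V r) (closed_ball0 V r) f.
  move=> x xB; have := flip (x, 0) (conj xB ball0).
  rewrite /= subr0 => fx; rewrite /closed_ball0 /= -(subrK (f 0) (f x)).
  apply: le_trans (ler_normD _ _) (le_trans (lerD fx f0) _).
  by rewrite mulrBl mul1r addrCA gerDl subr_le0 ler_wpM2l.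
pose F : {fun closed_ball0 V r >-> closed_ball0 V r} :=
  HB.pack f (isFun.Build V V _ _ f fB).
have F_contr : normed_module.is_contraction F by exists (NngNum q_ge0).
have [|x xB xE] := banach_fixed_point F_contr (@closed_ball0_closed r).
  by exists 0.
by exists x.
Qed.

(* Solved by iterating [x |-> - g (q x + s *: T x)]. *)
Lemma near_perturbed_root (f : V -> V) (g : {linear V -> V}) (k : R)
    (q T : V -> V) (l : R) :
  cancel g f -> 0 < k -> (forall x, `|g x| <= k * `|x|) ->
  q 0 = 0 ->
  (forall e : R, 0 < e ->
     \forall r \near 0^'+, e.-lipschitz_(closed_ball0 V r) q) ->
  l.-lipschitz_(closed_ball0 V 1) T ->
  forall e : R, 0 < e ->
  \forall s \near 0^'+, exists2 x, `|x| <= e & f x + q x + s *: T x = 0.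
Proof.
move=> gK k_gt0 g_le q0 q_lip T_lip e e_gt0.
near (0 : R)^'+ => r.
have r_gt0 : 0 < r by [].
have r_le1 : r <= 1 by near: r; apply: nbhs_right_le.
have r_lee : r <= e by near: r; apply: nbhs_right_le.
near=> s.
have s_gt0 : 0 < s by [].
have T_small : s * (k * l) < 4^-1.
  by near: s; apply: nbhs_right0_mul_lt; rewrite invr_gt0.
have T0_small : s * (k * `|T 0|) < r / 2.
  by near: s; apply: nbhs_right0_mul_lt; rewrite divr_gt0.
have q_small : (4 * k)^-1.-lipschitz_(closed_ball0 V r) q.
  by near: r; apply: q_lip; rewrite invr_gt0 mulr_gt0.
pose F x := - g (q x + s *: T x).
have F_lip : (2^-1).-lipschitz_(closed_ball0 V r) F.
  move=> [x y] /= [xr yr]; rewrite -opprD normrN -linearB /=.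
  have Txy := T_lip (x, y) (conj (le_trans xr r_le1) (le_trans yr r_le1)).
  have qxy := q_small (x, y) (conj xr yr).
  rewrite /= in Txy qxy.
  apply: le_trans (g_le _) _; rewrite opprD addrACA -scalerBr.
  apply: (@le_trans _ _ (k * ((4 * k)^-1 * `|x - y| + s * (l * `|x - y|)))).
    rewrite ler_pM2l //; apply: le_trans (ler_normD _ _) _.
    by rewrite lerD // normrZ gtr0_norm // ler_pM2l.
  have -> : k * ((4 * k)^-1 * `|x - y| + s * (l * `|x - y|))
      = (4^-1 + s * (k * l)) * `|x - y| by field; rewrite gt_eqF.
  by rewrite ler_wpM2r //; lra.
have F0 : `|F 0| <= (1 - 2^-1) * r.
  rewrite normrN q0 add0r; apply: le_trans (g_le _) _.
  rewrite normrZ gtr0_norm // mulrCA; lra.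
have half_lt1 : 0 <= (2^-1 : R) < 1 by lra.
have [x xr xE] := lipschitz_fixed_point half_lt1 F0 F_lip.
exists x; first exact: le_trans r_lee.
by rewrite -addrA -[in f x]xE /F -linearN gK addrC subrr.
Unshelve. all: by end_near. Qed.

End PerturbedRoot.

HB.instance Definition _ (R : realType) m n := Complete.on 'M[R]_(m, n).

Section MatrixNorm.
Variable R : realFieldType.

Lemma mx_norm_entry m n (X : 'M[R]_(m, n)) i j : `|X i j| <= `|X|.
Proof.
rewrite [`|X|]mx_normrE.
exact: (le_bigmax _ (fun ij : 'I_m * 'I_n => `|X ij.1 ij.2|) (i, j)).
Qed.

Lemma mx_norm_le m n (X : 'M[R]_(m, n)) c :
  0 <= c -> (forall i j, `|X i j| <= c) -> `|X| <= c.
Proof. by move=> c_ge0 Xc; rewrite [`|X|]mx_normrE; apply: bigmax_le. Qed.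

Lemma mx_norm_tr m n (X : 'M[R]_(m, n)) : `|X^T| = `|X|.
Proof.
have le_tr p q (Y : 'M[R]_(p, q)) : `|Y^T| <= `|Y|.
  by apply: mx_norm_le => // i j; rewrite mxE mx_norm_entry.
by apply/eqP; rewrite eq_le le_tr -{1}[X]trmxK le_tr.
Qed.

Lemma mx_norm_row' m n (i : 'I_m) (X : 'M[R]_(m, n)) : `|row' i X| <= `|X|.
Proof. by apply: mx_norm_le => // k l; rewrite mxE mx_norm_entry. Qed.

Lemma mx_norm_mul m n p (X : 'M[R]_(m, n)) (Y : 'M[R]_(n, p)) :
  `|X *m Y| <= n%:R * `|X| * `|Y|.
Proof.
apply: mx_norm_le => [|i j]; first by rewrite !mulr_ge0.
rewrite mxE; apply: le_trans (ler_norm_sum _ _ _) _.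
have -> : n%:R * `|X| * `|Y| = \sum_(k < n) `|X| * `|Y|.
  by rewrite sumr_const card_ord mulr_natl -mulrnAl.
by apply: ler_sum => k _; rewrite normrM ler_pM ?mx_norm_entry.
Qed.

Lemma mx_norm_gram n (c : 'rV[R]_n) : `|c^T *m c| <= `|c| ^+ 2.
Proof. by apply: le_trans (mx_norm_mul _ _) _; rewrite mul1r mx_norm_tr. Qed.

Lemma unitmx_addl1 n (K : 'M[R]_n) : n%:R * `|K| < 1 -> 1%:M + K \in unitmx.
Proof.
move=> K_lt1; rewrite -row_free_unit -kermx_eq0.
rewrite -normr_eq0 eq_le normr_ge0 andbT.
set Y := kermx _.
have /eqP : Y *m (1%:M + K) = 0 by rewrite mulmx_ker.
rewrite mulmxDr mulmx1 addr_eq0 => /eqP YE.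
have := mx_norm_mul Y K; rewrite -normrN -YE mulrAC => Y_le.
by rewrite leNgt; apply/negP => Y_gt0; nra.
Qed.

Lemma linear_mx_bounded m n (V : normedModType R)
    (f : {linear 'M[R]_(m, n) -> V}) :
  exists2 k, 0 < k & forall X, `|f X| <= k * `|X|.
Proof.
pose k := \sum_i \sum_j `|f (delta_mx i j)|.
have k_ge0 : 0 <= k by apply: sumr_ge0 => i _; apply: sumr_ge0.
exists (1 + k) => [|X]; first by rewrite ltr_pwDl.
apply: (@le_trans _ _ (k * `|X|)); last by rewrite ler_wpM2r ?lerDr.
rewrite {1}[X]matrix_sum_delta linear_sum mulr_suml /=.
apply: le_trans (ler_norm_sum _ _ _) _; apply: ler_sum => i _.
rewrite linear_sum mulr_suml /=; apply: le_trans (ler_norm_sum _ _ _) _.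
apply: ler_sum => j _; rewrite linearZ /= normrZ mulrC.
by rewrite ler_wpM2l ?mx_norm_entry.
Qed.

Lemma linear_mx_bounded_inverse m n
    (f : {linear 'M[R]_(m, n) -> 'M[R]_(m, n)}) :
  (forall X, f X = 0 -> X = 0) ->
  exists g : {linear 'M[R]_(m, n) -> 'M[R]_(m, n)}, exists2 k, 0 < k &
    [/\ cancel f g, cancel g f & forall X, `|g X| <= k * `|X|].
Proof.
move=> f_ker0.
have ker0 : lker (linfun f) == 0%VS.
  apply/lker0P => X Y; rewrite !lfunE /= => fXY.
  by apply/subr0_eq/f_ker0; rewrite linearB /= fXY subrr.
pose g : {linear 'M[R]_(m, n) -> 'M[R]_(m, n)} := (linfun f)^-1%VF.
have [k k_gt0 k_bound] := linear_mx_bounded g.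
exists g, k => //; split=> // X.
  by have := lker0_lfunK ker0 X; rewrite lfunE.
by have := lker0_lfunVK ker0 X; rewrite lfunE.
Qed.

Lemma mx_quad_lipschitz m n p q (f : {linear 'M[R]_(m, n) -> 'M[R]_(p, q)})
    (N : 'M[R]_p) :
  exists k, forall r,
    (k * r).-lipschitz_(closed_ball0 'M[R]_(m, n) r)
      (fun X => (f X)^T *m N *m f X).
Proof.
have [k k_gt0 k_bound] := linear_mx_bounded f.
have bilinear_le (Y Z : 'M[R]_(p, q)) :
    `|Y^T *m N *m Z| <= p%:R ^+ 2 * `|N| * `|Y| * `|Z|.
  apply: le_trans (mx_norm_mul _ _) _; rewrite ler_wpM2r // expr2 -2!mulrA.
  rewrite ler_wpM2l // mulrA mulrAC -(mx_norm_tr Y).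
  exact: mx_norm_mul.
exists (2 * (p%:R ^+ 2 * `|N| * k ^+ 2)) => r [X Y] /= [Xr Yr].
have -> : (f X)^T *m N *m f X - (f Y)^T *m N *m f Y =
    (f X)^T *m N *m f (X - Y) + (f (X - Y))^T *m N *m f Y.
  by rewrite linearB mulmxBr [(_ - _)^T]linearB /= !mulmxBl addrA subrK.
have cross_le Z : `|Z| <= r -> p%:R ^+ 2 * `|N| * `|f Z| * `|f (X - Y)|
    <= p%:R ^+ 2 * `|N| * k ^+ 2 * r * `|X - Y|.
  move=> Zr; have fZ := le_trans (k_bound Z) (ler_wpM2l (ltW k_gt0) Zr).
  have -> : p%:R ^+ 2 * `|N| * k ^+ 2 * r * `|X - Y|
      = p%:R ^+ 2 * `|N| * (k * r) * (k * `|X - Y|) by ring.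
  by rewrite ler_pM ?mulr_ge0 // ler_wpM2l // mulr_ge0.
apply: le_trans (ler_normD _ _) _.
apply: le_trans (lerD (bilinear_le _ _) (bilinear_le _ _)) _.
have := cross_le X Xr; have := cross_le Y Yr; lra.
Qed.

End MatrixNorm.

Section Frobenius.
Variables (R : realDomainType) (m n : nat).
Implicit Types X : 'M[R]_(m, n).

Lemma mxtrace_trmul X : \tr (X^T *m X) = \sum_j \sum_i X i j ^+ 2.
Proof.
by apply: eq_bigr => j _; rewrite mxE; apply: eq_bigr => i _; rewrite mxE.
Qed.

Lemma mxtrace_trmul_ge0 X : 0 <= \tr (X^T *m X).
Proof.
rewrite mxtrace_trmul; apply: sumr_ge0 => j _; apply: sumr_ge0 => i _.
exact: sqr_ge0.
Qed.

Lemma mxtrace_trmul_eq0 X : \tr (X^T *m X) = 0 -> X = 0.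
Proof.
rewrite mxtrace_trmul => /eqP; rewrite psumr_eq0; last first.
  by move=> j _; apply: sumr_ge0 => i _; apply: sqr_ge0.
move=> /allP X0; apply/matrixP => i j; rewrite mxE; apply/eqP.
have := X0 j; rewrite mem_index_enum psumr_eq0 => [|k _]; last exact: sqr_ge0.
by move=> /(_ isT)/allP/(_ i); rewrite mem_index_enum sqrf_eq0; apply.
Qed.

End Frobenius.

Section PatternPart.
Variables (R : realType) (n : nat) (G : sgraph n).
Implicit Types A X : 'M[R]_n.

Definition pattern_part X : 'M[R]_n :=
  \matrix_(a, b) (if (a == b) || edge G a b then X a b else 0).

Lemma pattern_part_linear : linear pattern_part.
Proof.
move=> c X Y; apply/matrixP => a b; rewrite !mxE.
by case: ifP; rewrite // mulr0 addr0.
Qed.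

HB.instance Definition _ :=
  GRing.isLinear.Build R 'M[R]_n 'M[R]_n *:%R pattern_part pattern_part_linear.

Lemma pattern_part_idem X : pattern_part (pattern_part X) = pattern_part X.
Proof. by apply/matrixP => a b; rewrite !mxE; case: (_ || _). Qed.

Lemma tr_pattern_part X : (pattern_part X)^T = pattern_part X^T.
Proof. by apply/matrixP => a b; rewrite !mxE eq_sym edge_sym. Qed.

Lemma norm_pattern_part X : `|pattern_part X| <= `|X|.
Proof.
apply: mx_norm_le => // a b; rewrite mxE.
by case: ifP => _; rewrite ?normr0 // mx_norm_entry.
Qed.

Lemma pattern_part_eq0P X :
  pattern_part X = 0 <-> forall a b, (a == b) || edge G a b -> X a b = 0.
Proof.
split=> [/matrixP X0 a b|X0].
  by have := X0 a b; rewrite !mxE => /[swap] ->.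
by apply/matrixP => a b; rewrite !mxE; case: ifP => // /X0.
Qed.

Lemma in_SP A :
  in_S G A <-> A^T = A /\ forall a b, a != b -> (A a b != 0) = edge G a b.
Proof.
split=> -[A_sym A_edge]; split=> // a b.
  by move=> /eqP/A_edge Aab; apply/idP/idP => [/eqP/Aab|/Aab/eqP].
by move=> /eqP/A_edge <-; split=> /eqP.
Qed.

Lemma pattern_part_in_S A : in_S G A -> pattern_part A = A.
Proof.
move=> /in_SP[_ A_edge]; apply/matrixP => a b; rewrite mxE.
have [->|ab] := eqVneq a b; first by [].
by rewrite -A_edge //=; case: eqP => [->|].
Qed.

Lemma pattern_part_eq0 A X : in_S G A ->
  pattern_part X = 0 <-> hadamard A X = 0 /\ hadamard 1%:M X = 0.
Proof.
move=> /in_SP[_ A_edge]; split=> [X0|[AX0 IX0]].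
  move/pattern_part_eq0P in X0; split; apply/matrixP => a b; rewrite !mxE.
    have [->|ab] := eqVneq a b; first by rewrite X0 ?eqxx ?mulr0.
    have [Gab|/negPf] := boolP (edge G a b).
      by rewrite X0 ?Gab ?orbT ?mulr0.
    by rewrite -A_edge // => /negbFE/eqP ->; rewrite mul0r.
  by have [->|] := eqVneq a b; rewrite ?mul0r // X0 ?eqxx ?mulr0.
apply/pattern_part_eq0P => a b; have [<- _|ab /=] := eqVneq a b.
  by have /matrixP/(_ a a) := IX0; rewrite !mxE eqxx mul1r.
rewrite -A_edge // => Aab.
have /matrixP/(_ a b) := AX0; rewrite !mxE => /eqP.
by rewrite mulf_eq0 (negPf Aab) => /eqP.
Qed.

Lemma SNIPP i A : in_S G A -> SNIP i A <->
  forall X, X^T = X -> pattern_part X = 0 -> row' i (A *m X) = 0 -> X = 0.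
Proof.
move=> A_in; split=> snipA X X_sym.
  by move=> /(pattern_part_eq0 _ A_in)[AX0 IX0]; apply: snipA.
by move=> AX0 IX0; apply: snipA => //; apply/(pattern_part_eq0 _ A_in).
Qed.

Lemma in_S_near A : in_S G A -> \forall e \near 0^'+, forall C,
  `|C - A| <= e -> C^T = C -> pattern_part C = C -> in_S G C.
Proof.
move=> /in_SP[A_sym A_edge].
have : \forall e \near (0 : R)^'+, forall ab : 'I_n * 'I_n,
    A ab.1 ab.2 != 0 -> e < `|A ab.1 ab.2|.
  apply: filter_forall => -[a b] /=; have [->|Aab] := eqVneq (A a b) 0.
    exact: nearW.
  by near=> e => _; near: e; apply: nbhs_right_lt; rewrite normr_gt0.
apply: filterS => e e_lt C CA C_sym C_pattern; apply/in_SP; split=> // a b ab.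
have [Gab|/negPf Gab] := boolP (edge G a b); last first.
  by rewrite -C_pattern mxE (negPf ab) Gab eqxx.
have := e_lt (a, b); rewrite /= A_edge // => /(_ Gab); apply: contraLR.
rewrite negbK => /eqP C0; rewrite -leNgt; apply: le_trans CA.
by have := mx_norm_entry (C - A) a b; rewrite !mxE C0 sub0r normrN.
Unshelve. all: by end_near. Qed.

End PatternPart.

Section SNIPOperator.
Variables (R : realType) (n : nat) (G : sgraph n) (i : 'I_n) (A : 'M[R]_n).

Definition SNIP_gen : 'M[R]_n := col' i 1%:M *m row' i A.

Definition del_gram : 'M[R]_n := (row' i A)^T *m row' i A.

(* For symmetric [A] and [X] the first two terms are [A *m K + K^T *m A] with
   [K = SNIP_gen *m X].  The term [X - X^T] vanishes on symmetric matrices and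
   makes the operator injective on all of them. *)
Definition SNIP_op (X : 'M[R]_n) : 'M[R]_n :=
  del_gram *m X + X *m del_gram + pattern_part G X + (X - X^T).

Lemma SNIP_op_linear : linear SNIP_op.
Proof.
move=> c X Y; rewrite /SNIP_op mulmxDr mulmxDl -scalemxAl -scalemxAr linearP /=.
by apply/matrixP => a b; rewrite !mxE; ring.
Qed.

HB.instance Definition _ :=
  GRing.isLinear.Build R 'M[R]_n 'M[R]_n *:%R SNIP_op SNIP_op_linear.

Lemma tr_del_gram : del_gram^T = del_gram.
Proof. by rewrite trmx_mul trmxK. Qed.

Lemma tr_SNIP_op X : (SNIP_op X)^T = SNIP_op X^T.
Proof.
rewrite /SNIP_op !linearD linearN /= [(del_gram *m _)^T]trmx_mul.
rewrite [(_ *m del_gram)^T]trmx_mul trmxK tr_del_gram tr_pattern_part.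
by congr (_ + _ + _); rewrite addrC.
Qed.

Lemma mxtrace_SNIP_op X : 2 * \tr (X^T *m SNIP_op X) =
  2 * (\tr ((row' i A *m X)^T *m (row' i A *m X))
     + \tr ((row' i A *m X^T)^T *m (row' i A *m X^T))
     + \tr ((pattern_part G X)^T *m pattern_part G X))
  + \tr ((X - X^T)^T *m (X - X^T)).
Proof.
have pattern_tr : \tr (X^T *m pattern_part G X) =
    \tr ((pattern_part G X)^T *m pattern_part G X).
  apply: eq_bigr => a _; rewrite !mxE; apply: eq_bigr => b _.
  by rewrite !mxE; case: ifP; rewrite ?mulr0 ?mul0r.
have antisym_tr : 2 * \tr (X^T *m (X - X^T)) = \tr ((X - X^T)^T *m (X - X^T)).
  rewrite [(X - _)^T]linearB /= trmxK mulmxBl !mulmxBr !linearB /=.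
  rewrite (mxtrace_mulC X X^T) -(mxtrace_tr (X *m X)) trmx_mul; ring.
rewrite -antisym_tr -pattern_tr -mulrDr /SNIP_op !mulmxDr !mxtraceD.
by rewrite (mxtrace_mulC X^T (X *m _)) /del_gram !trmx_mul trmxK !mulmxA.
Qed.

Lemma SNIP_op_inj : in_S G A -> SNIP i A -> forall X, SNIP_op X = 0 -> X = 0.
Proof.
move=> A_in /(SNIPP _ A_in) snipA X X0.
have := mxtrace_SNIP_op X; rewrite X0 mulmx0 mxtrace0 mulr0.
have := mxtrace_trmul_ge0 (row' i A *m X).
have := mxtrace_trmul_ge0 (row' i A *m X^T).
have := mxtrace_trmul_ge0 (pattern_part G X).
have := mxtrace_trmul_ge0 (X - X^T) => ? ? ? ? ?.
apply: snipA.
- by apply/esym/subr0_eq/mxtrace_trmul_eq0; lra.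
- by apply: mxtrace_trmul_eq0; lra.
- by rewrite row'_mul; apply: mxtrace_trmul_eq0; lra.
Qed.

Lemma row_SNIP_gen p (X : 'M[R]_(n, p)) : row i (SNIP_gen *m X) = 0.
Proof.
have row0 : row i (col' i (1%:M : 'M[R]_n)) = 0.
  by apply/rowP => b; rewrite !mxE (negPf (neq_lift _ _)).
by rewrite /SNIP_gen -mulmxA row_mul row0 mul0mx.
Qed.

Lemma SNIP_gen_congr (X : 'M[R]_n) : A^T = A -> X^T = X ->
  let K := SNIP_gen *m X in
  (1%:M + K)^T *m A *m (1%:M + K)
    = A + SNIP_op X - pattern_part G X + K^T *m A *m K.
Proof.
move=> A_sym X_sym /=; set K := SNIP_gen *m X.
have AK : A *m K = del_gram *m X.
  rewrite /K /SNIP_gen /del_gram !mulmxA; congr (_ *m _ *m _).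
  by rewrite tr_row' A_sym !col'Esub mulmx_colsub mulmx1.
have KA : K^T *m A = X *m del_gram.
  rewrite -[K^T *m A]trmxK trmx_mul trmxK A_sym AK.
  by rewrite trmx_mul tr_del_gram X_sym.
rewrite [(_ + K)^T]linearD /= trmx1 mulmxDl mul1mx mulmxDr mulmx1 mulmxDl.
rewrite AK {1}KA /SNIP_op X_sym subrr addr0 [in RHS]addrA addrK.
by rewrite [_ *m X + X *m _]addrC !addrA.
Qed.

End SNIPOperator.

(* What the SNIP of [split_mx] comes down to for [C - s *: (c^T *m c)]. *)
Definition relaxed_SNIP (R : realType) n (G : sgraph n) (i : 'I_n) (s : R)
    (c : 'rV[R]_n) (C : 'M[R]_n) : Prop :=
  forall Y : 'M[R]_n, Y^T = Y -> `|pattern_part G Y| <= s * `|c *m Y| ->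
    row' i ((C - s *: (c^T *m c)) *m Y) = 0 -> Y = 0.

Section SNIPPerturbation.
Variables (R : realType) (n : nat) (G : sgraph n) (i : 'I_n) (A : 'M[R]_n).
Hypotheses (A_in : in_S G A) (snipA : SNIP i A).

Lemma SNIP_stable : \forall e \near 0^'+, forall B Y,
  `|B - A| <= e -> Y^T = Y -> `|pattern_part G Y| <= e * `|Y| ->
  row' i (B *m Y) = 0 -> Y = 0.
Proof.
have [g [k k_gt0 [opK _ g_le]]] :=
  linear_mx_bounded_inverse (SNIP_op_inj A_in snipA).
pose c := n.-1%:R * `|row' i A| * n%:R.
near=> e => B Y BA Y_sym Y_pattern BY0.
have gram_le : `|del_gram i A *m Y| <= c * (e * `|Y|).
  have -> : del_gram i A *m Y = (row' i A)^T *m row' i ((A - B) *m Y).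
    by rewrite mulmxBl linearB /= BY0 subr0 row'_mul mulmxA.
  apply: le_trans (mx_norm_mul _ _) _; rewrite mx_norm_tr -[leRHS]mulrA.
  rewrite ler_wpM2l //; apply: le_trans (mx_norm_row' _ _) _.
  apply: le_trans (mx_norm_mul _ _) _; rewrite -mulrA ler_wpM2l // ler_wpM2r //.
  by rewrite distrC.
have tr_gram_le : `|Y *m del_gram i A| <= c * (e * `|Y|).
  by rewrite -mx_norm_tr trmx_mul tr_del_gram Y_sym.
have op_le : `|SNIP_op G i A Y| <= (2 * c + 1) * (e * `|Y|).
  rewrite /SNIP_op Y_sym subrr addr0.
  have := ler_normD (del_gram i A *m Y) (Y *m del_gram i A).
  have := ler_normD (del_gram i A *m Y + Y *m del_gram i A) (pattern_part G Y).
  lra.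
have e_small : e * (k * (2 * c + 1)) < 1.
  by near: e; apply: nbhs_right0_mul_lt.
have Y_le : `|Y| <= e * (k * (2 * c + 1)) * `|Y|.
  rewrite -{1}(opK Y); apply: le_trans (g_le _) _.
  have -> : e * (k * (2 * c + 1)) * `|Y| = k * ((2 * c + 1) * (e * `|Y|)).
    by ring.
  by rewrite ler_pM2l.
apply/eqP; rewrite -normr_eq0 eq_le normr_ge0 andbT leNgt; apply/negP => Y_gt0.
by move: Y_le; rewrite leNgt gtr_pMl // e_small.
Unshelve. all: by end_near. Qed.

Lemma relaxed_SNIP_near : \forall e \near 0^'+, forall s c C,
  0 < s -> `|C - A| <= e -> s * `|c| ^+ 2 <= e -> s * (n%:R * `|c|) <= e ->
  relaxed_SNIP G i s c C.
Proof.
near (0 : R)^'+ => d; have d_gt0 : 0 < d by [].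
have stable : forall B Y, `|B - A| <= d -> Y^T = Y ->
    `|pattern_part G Y| <= d * `|Y| -> row' i (B *m Y) = 0 -> Y = 0.
  by near: d; apply: SNIP_stable.
near=> e => s c C s_gt0 CA s_gram s_row Y Y_sym Y_pattern.
have e_le : e <= d / 2 by near: e; apply: nbhs_right_le; rewrite divr_gt0.
apply: stable => //.
  rewrite addrAC; apply: le_trans (ler_normB _ _) _.
  have := ler_wpM2l (ltW s_gt0) (mx_norm_gram c).
  by rewrite normrZ gtr0_norm //; lra.
apply: le_trans Y_pattern _.
apply: le_trans (ler_wpM2l (ltW s_gt0) (mx_norm_mul _ _)) _.
by rewrite mulrA ler_wpM2r //; lra.
Unshelve. all: by end_near. Qed.

Section Perturbation.
Variable T : 'M[R]_n -> 'M[R]_n.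
Hypothesis tr_T : forall C, (T C)^T = T C.
Hypothesis T_lip : forall r, exists l, l.-lipschitz_(closed_ball0 'M[R]_n r) T.

Lemma SNIP_op_perturbed_root (e : R) : 0 < e -> \forall s \near 0^'+,
  exists X, let K := SNIP_gen i A *m X in
    [/\ `|X| <= e, X^T = X
      & SNIP_op G i A X = s *: T (A - pattern_part G X) - K^T *m A *m K].
Proof.
move=> e_gt0; have [A_sym _] := A_in.
have [g [k k_gt0 [opK gK g_le]]] :=
  linear_mx_bounded_inverse (SNIP_op_inj A_in snipA).
pose K : {linear 'M[R]_n -> 'M[R]_n} := mulmx (SNIP_gen i A).
pose C X := A - pattern_part G X.
have q0 : (K 0)^T *m A *m K 0 = 0 by rewrite linear0 mulmx0.
have q_lip d : 0 < d -> \forall r \near 0^'+,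
    d.-lipschitz_(closed_ball0 'M[R]_n r) (fun X => (K X)^T *m A *m K X).
  have [l l_lip] := mx_quad_lipschitz K A.
  move=> d_gt0; near=> r => XY XYr; apply: le_trans (l_lip r XY XYr) _.
  rewrite ler_wpM2r // mulrC ltW //; near: r; exact: nbhs_right0_mul_lt.
have [t t_lip] := T_lip (`|A| + 1).
have TC_lip : `|t|.-lipschitz_(closed_ball0 'M[R]_n 1) (fun X => - T (C X)).
  have C_ball X : `|X| <= 1 -> `|C X| <= `|A| + 1.
    move=> X1; apply: le_trans (ler_normB _ _) _.
    by rewrite lerD2l (le_trans (norm_pattern_part _ _)).
  move=> [X Y] /= [X1 Y1]; rewrite -opprD normrN.
  apply: le_trans (t_lip (C X, C Y) (conj (C_ball X X1) (C_ball Y Y1))) _.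
  apply: le_trans (ler_wpM2r (normr_ge0 _) (ler_norm t)) _.
  rewrite ler_wpM2l //= /C opprB addrC addrA subrK -linearB distrC.
  exact: norm_pattern_part.
have := near_perturbed_root gK k_gt0 g_le q0 q_lip TC_lip e_gt0.
apply: filterS => s [X Xe opX]; exists X => /=.
have opXE : SNIP_op G i A X = s *: T (C X) - (K X)^T *m A *m K X.
  by move/eqP: opX; rewrite scalerN subr_eq0 => /eqP <-; rewrite addrK.
split=> //; apply: (can_inj opK).
rewrite /= -tr_SNIP_op opXE linearB linearZ /= tr_T.
by rewrite trmx_mul [(_^T *m A)^T]trmx_mul trmxK A_sym mulmxA.
Unshelve. all: by end_near. Qed.

(* Transversality of [S(G)] and the congruence orbit of [A]: after any small
   perturbation [s *: T], the two still meet near [A]. *)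
Lemma SNIP_congruence (e : R) : 0 < e -> \forall s \near 0^'+,
  exists C K : 'M[R]_n,
    [/\ in_S G C, `|C - A| <= e, `|K| <= e, row i K = 0
      & (1%:M + K)^T *m A *m (1%:M + K) = C + s *: T C].
Proof.
move=> e_gt0; have [A_sym _] := A_in.
pose K : {linear 'M[R]_n -> 'M[R]_n} := mulmx (SNIP_gen i A).
have [k k_gt0 K_le] := linear_mx_bounded K.
near (0 : R)^'+ => r.
have r_gt0 : 0 < r by [].
have r_lee : r <= e by near: r; apply: nbhs_right_le.
have rk_lte : r * k < e by near: r; apply: nbhs_right0_mul_lt.
have in_S_r : forall C, `|C - A| <= r -> C^T = C ->
    pattern_part G C = C -> in_S G C by near: r; apply: in_S_near.
have := SNIP_op_perturbed_root r_gt0.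
apply: filterS => s [X [Xr X_sym opX]].
have CA : `|A - pattern_part G X - A| <= r.
  by rewrite addrC addKr normrN (le_trans (norm_pattern_part _ _)).
exists (A - pattern_part G X), (K X); split.
- apply: in_S_r => //.
  + by rewrite linearB /= tr_pattern_part X_sym A_sym.
  + by rewrite linearB /= pattern_part_idem pattern_part_in_S.
- exact: le_trans r_lee.
- apply: le_trans (K_le X) (le_trans _ (ltW rk_lte)).
  by rewrite mulrC ler_pM2r.
- exact: row_SNIP_gen.
rewrite (SNIP_gen_congr G i A_sym X_sym) opX.
by rewrite [A + _ - _]addrAC -[LHS]addrA subrK.
Unshelve. all: by end_near. Qed.

End Perturbation.

End SNIPPerturbation.

Section NullityPair.
Variable R : realType.

Lemma nullityE n (A : 'M[R]_n) : nullity A = (n - \rank A)%N.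
Proof. exact: mxrank_coker. Qed.

Lemma nullity_congr m n (A : 'M[R]_n) (L : 'M[R]_(n, m)) (M : 'M[R]_(m, n)) :
  L *m M = 1%:M -> M *m L = 1%:M -> nullity (L^T *m A *m L) = nullity A.
Proof.
move=> LM ML; have mn : m = n.
  by apply/eqP; rewrite eqn_leq (mulmx1_min LM) (mulmx1_min ML).
rewrite !nullityE; congr (_ - _)%N => //.
rewrite mxrankMfree; last by apply/row_freeP; exists M.
rewrite eqmxMfull //; apply/row_fullP; exists M^T.
by rewrite -trmx_mul LM trmx1.
Qed.

Lemma nullity_pair_congr m n (i : 'I_n) (j : 'I_m) (A : 'M[R]_n)
    (L : 'M[R]_(n, m)) (M : 'M[R]_(m, n)) :
  L *m M = 1%:M -> M *m L = 1%:M -> row i L = delta_mx 0 j ->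
  nullity_pair j (L^T *m A *m L) = nullity_pair i A.
Proof.
move=> LM ML Li.
have Mj : row j M = delta_mx 0 i by rewrite rowE -Li -row_mul LM row1.
have L0 : row i (col' j L) = 0 by apply: row_col'_delta.
have M0 : row j (col' i M) = 0 by apply: row_col'_delta.
rewrite /nullity_pair (nullity_congr _ LM ML); congr (_, _).
pose L' := row' i (col' j L); pose M' := row' j (col' i M).
have -> : principal_del j (L^T *m A *m L) = L'^T *m principal_del i A *m L'.
  rewrite /principal_del (row'_col'_mul _ _ L0); congr (_ *m _).
  apply: trmx_inj; rewrite trmx_mul trmxK !tr_row' !tr_col' trmx_mul trmxK.
  by rewrite !col'_row' (row'_col'_mul _ _ L0).
apply: (@nullity_congr _ _ _ _ M').
  by rewrite -(row'_col'_mul _ _ M0) LM row'_col'1.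
by rewrite -(row'_col'_mul _ _ L0) ML row'_col'1.
Qed.

Lemma nullity_pair_block n p (i : 'I_n) (B : 'M[R]_n) (D : 'M[R]_p) :
  D \in unitmx ->
  nullity_pair (lshift p i) (block_mx B 0 0 D) = nullity_pair i B.
Proof.
have nullity_block q (C : 'M[R]_q) : D \in unitmx ->
    nullity (block_mx C 0 0 D) = nullity C.
  move=> D_unit; rewrite !nullityE rank_diag_block_mx (mxrank_unit D_unit).
  by rewrite subnDr.
case: n => [|n] in i B *; first by case: i.
move=> D_unit; rewrite /nullity_pair nullity_block //; congr (_, _).
rewrite -(nullity_block _ (principal_del i B)) //; congr nullity.
rewrite /principal_del /block_mx col'_col_mx !col'Kl row'Ku.
by rewrite row'_row_mx !linear0.
Qed.

Lemma nullity_pair_congr_addl1 n (i : 'I_n) (A K : 'M[R]_n) :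
  row i K = 0 -> 1%:M + K \in unitmx ->
  nullity_pair i ((1%:M + K)^T *m A *m (1%:M + K)) = nullity_pair i A.
Proof.
move=> Ki K_unit; apply: (nullity_pair_congr _ (mulmxV K_unit) (mulVmx K_unit)).
by rewrite linearD /= Ki addr0 row1.
Qed.

End NullityPair.

Lemma SNIP_rank1_perturbation (R : realType) n (G : sgraph n) (i : 'I_n)
    (A : 'M[R]_n) (c : {linear 'M[R]_n -> 'rV[R]_n}) :
  in_S G A -> SNIP i A ->
  exists (s : R) (C : 'M[R]_n),
    [/\ 0 < s, in_S G C, relaxed_SNIP G i s (c C) C
      & nullity_pair i (C - s *: ((c C)^T *m c C)) = nullity_pair i A].
Proof.
move=> A_in snipA; pose T C : 'M[R]_n := - ((c C)^T *m c C).
have tr_T C : (T C)^T = T C by rewrite linearN /= trmx_mul trmxK.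
have T_lip r : exists l, l.-lipschitz_(closed_ball0 'M[R]_n r) T.
  have [l l_lip] := mx_quad_lipschitz c (- 1%:M).
  exists (l * r) => CD CDr; have := l_lip r CD CDr.
  by rewrite /= !mulmxN !mulNmx !mulmx1.
have [k k_gt0 c_bound] := linear_mx_bounded c; pose M := k * (`|A| + 1).
near (0 : R)^'+ => e; have e_gt0 : 0 < e by [].
have e_le1 : e <= 1 by near: e; apply: nbhs_right_le.
have e_small : e * n%:R < 1 by near: e; apply: nbhs_right0_mul_lt.
have relaxed : forall s c C, 0 < s -> `|C - A| <= e ->
    s * `|c| ^+ 2 <= e -> s * (n%:R * `|c|) <= e -> relaxed_SNIP G i s c C.
  by near: e; apply: relaxed_SNIP_near.
near (0 : R)^'+ => s; have s_gt0 : 0 < s by [].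
have s_gram : s * M ^+ 2 < e by near: s; apply: nbhs_right0_mul_lt.
have s_row : s * (n%:R * M) < e by near: s; apply: nbhs_right0_mul_lt.
have [C [K [C_in CA Ke Ki CK]]] : exists C K : 'M[R]_n,
    [/\ in_S G C, `|C - A| <= e, `|K| <= e, row i K = 0
      & (1%:M + K)^T *m A *m (1%:M + K) = C + s *: T C].
  by near: s; apply: SNIP_congruence.
have cC_le : `|c C| <= M.
  apply: le_trans (c_bound C) _; rewrite ler_pM2l //.
  by have := ler_normD A (C - A); rewrite addrC subrK; lra.
have K_unit : 1%:M + K \in unitmx.
  by apply: unitmx_addl1; apply: le_lt_trans e_small; rewrite mulrC ler_wpM2r.
exists s, C; split=> //; last by rewrite -scalerN -CK nullity_pair_congr_addl1.
apply: relaxed => //.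
  apply: le_trans (ltW s_gram); rewrite ler_pM2l // ler_pXn2r // nnegrE //.
  exact: le_trans cC_le.
by apply: le_trans (ltW s_row); rewrite ler_pM2l // ler_wpM2l.
Unshelve. all: by end_near. Qed.

Section VertexSplit.
Variables (F : fieldType) (m n : nat) (u : 'I_m) (w : 'I_n).
Variable psi : 'I_n -> 'I_m.
Hypothesis psi_inj : injective psi.
Hypothesis psi_neq : forall a, psi a != u.
Hypothesis psi_onto : forall x, x != u -> exists a, x = psi a.

Definition restr_mx : 'M[F]_(n, m) := rowsub psi 1%:M.
Local Notation Q := restr_mx.

Definition edge_row : 'rV[F]_m := delta_mx 0 u - delta_mx 0 (psi w).
Local Notation d := edge_row.

Lemma restr_mxE p (X : 'M[F]_(m, p)) : Q *m X = rowsub psi X.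
Proof. by rewrite mul_rowsub_mx mul1mx. Qed.

Lemma restr_mx_tr : Q *m Q^T = 1%:M.
Proof.
apply/matrixP => a b; rewrite restr_mxE !mxE.
by rewrite (inj_eq psi_inj) eq_sym.
Qed.

Lemma restr_mx_delta : Q *m delta_mx u 0 = 0 :> 'cV_n.
Proof.
by apply/matrixP => a b; rewrite restr_mxE !mxE (negPf (psi_neq a)).
Qed.

Lemma tr_restr_mx_mul_psi p (Z : 'M[F]_(n, p)) a l :
  (Q^T *m Z) (psi a) l = Z a l.
Proof.
by rewrite -[Z in RHS]mul1mx -restr_mx_tr -mulmxA restr_mxE [RHS]mxE.
Qed.

Lemma tr_restr_mx_mul_u p (Z : 'M[F]_(n, p)) l : (Q^T *m Z) u l = 0.
Proof.
have -> : (Q^T *m Z) u l = (row u (Q^T *m Z)) 0 l by rewrite [RHS]mxE.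
by rewrite row_mul -tr_col colE restr_mx_delta trmx0 mul0mx mxE.
Qed.

Lemma mul_restr_mx_psi p (Z : 'M[F]_(p, n)) k a : (Z *m Q) k (psi a) = Z k a.
Proof. by rewrite -[_ *m _]trmxK mxE trmx_mul tr_restr_mx_mul_psi mxE. Qed.

Lemma mul_restr_mx_u p (Z : 'M[F]_(p, n)) k : (Z *m Q) k u = 0.
Proof. by rewrite -[_ *m _]trmxK mxE trmx_mul tr_restr_mx_mul_u. Qed.

Lemma edge_row_u : d 0 u = 1.
Proof. by rewrite !mxE !eqxx eq_sym (negPf (psi_neq w)) subr0. Qed.

Lemma edge_row_psi a : d 0 (psi a) = - (a == w)%:R.
Proof. by rewrite !mxE (negPf (psi_neq a)) (inj_eq psi_inj) sub0r. Qed.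

Lemma split_rowP p (X Y : 'M[F]_(m, p)) :
  rowsub psi X = rowsub psi Y -> row u X = row u Y -> X = Y.
Proof.
move=> XY_psi XY_u; apply/row_matrixP => x.
have [->//|/psi_onto[a ->]] := eqVneq x u.
by apply/rowP => l; have /matrixP/(_ a l) := XY_psi; rewrite !mxE.
Qed.

Lemma tr_restr_mxK : Q^T *m Q = 1%:M - delta_mx u u.
Proof.
rewrite -(mul_delta_mx (0 : 'I_1)); apply: split_rowP.
  rewrite -!restr_mxE mulmxA restr_mx_tr mul1mx mulmxBr mulmx1 mulmxA.
  by rewrite restr_mx_delta mul0mx subr0.
apply/rowP => l; rewrite mxE tr_restr_mx_mul_u.
by rewrite linearB /= row1 row_mul rowE !mul_delta_mx subrr mxE.
Qed.

Section SplitMatrix.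
Variables (s : F) (c : 'rV[F]_n).
Hypothesis s_neq0 : s != 0.

(* The matrix of the quadratic form [C] on [V(G)], pulled back to [V(H)] with
   the part [c] of row [w] carried by [u] instead of [psi w], plus
   [s^-1 * (x_u - x_(psi w)) ^+ 2]. *)
Definition split_mx (C : 'M[F]_n) : 'M[F]_m :=
  Q^T *m C *m Q + d^T *m (c *m Q) + (c *m Q)^T *m d + s^-1 *: (d^T *m d).

Definition elim_row : 'rV[F]_m := d + s *: (c *m Q).
Local Notation h := elim_row.

Definition split_frame : 'M[F]_(n + 1, m) := col_mx Q h.

Definition split_frame_inv : 'M[F]_(m, n + 1) :=
  row_mx (Q^T - delta_mx u 0 *m (h *m Q^T)) (delta_mx u 0).

Lemma elim_row_delta : h *m delta_mx u 0 = 1%:M.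
Proof.
rewrite mulmxDl mulmxBl -scalemxAl -mulmxA restr_mx_delta mulmx0 scaler0 addr0.
rewrite mul_delta_mx (mul_delta_mx_0 _ _ _ (psi_neq w)) subr0.
by apply/matrixP => a b; rewrite !ord1 !mxE.
Qed.

Lemma tr_elim_row_mul_u p (Z : 'rV[F]_p) l : (h^T *m Z) u l = Z 0 l.
Proof.
have -> : (h^T *m Z) u l = (row u (h^T *m Z)) 0 l by rewrite [RHS]mxE.
by rewrite row_mul -tr_col colE elim_row_delta trmx1 mul1mx.
Qed.

Lemma split_frameK : split_frame *m split_frame_inv = 1%:M.
Proof.
rewrite mul_col_row !mulmxBr !mulmxA restr_mx_tr restr_mx_delta elim_row_delta.
by rewrite !mul0mx mul1mx subr0 subrr -scalar_mx_block.
Qed.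

Lemma split_frame_invK : split_frame_inv *m split_frame = 1%:M.
Proof.
rewrite mul_row_col mulmxBl -!mulmxA tr_restr_mxK [h *m _]mulmxBr mulmx1.
rewrite -(mul_delta_mx (0 : 'I_1)) [h *m _]mulmxA elim_row_delta mul1mx.
by rewrite mulmxBr opprB addrA addrNK subrK.
Qed.

Lemma split_mx_congr C : split_mx C =
  split_frame^T *m block_mx (C - s *: (c^T *m c)) 0 0 s^-1%:M *m split_frame.
Proof.
rewrite tr_col_mx mul_row_block !mulmx0 addr0 add0r mul_row_col.
rewrite mul_mx_scalar -scalemxAl /split_mx /elim_row.
have -> : Q^T *m (C - s *: (c^T *m c)) *m Q =
    Q^T *m C *m Q - s *: ((c *m Q)^T *m (c *m Q)).
  rewrite [Q^T *m (_ - _)]mulmxBr [(_ - _) *m Q]mulmxBl -scalemxAr -scalemxAl.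
  by rewrite trmx_mul !mulmxA.
move: (c *m Q) (Q^T *m C *m Q) d => y Z x.
by apply/matrixP => a b; rewrite !mxE !big_ord1 !mxE; field.
Qed.

Lemma split_mx_mul C p (X : 'M[F]_(m, p)) :
  split_mx C *m X = Q^T *m ((C - s *: (c^T *m c)) *m rowsub psi X)
                    + s^-1 *: (h^T *m (h *m X)).
Proof.
rewrite split_mx_congr -mulmxA mul_col_mx restr_mxE -mulmxA mul_block_col.
rewrite !mul0mx addr0 add0r tr_col_mx mul_row_col mul_scalar_mx.
by rewrite -scalemxAr.
Qed.

Lemma split_mx_ker C p (X : 'M[F]_(m, p)) a :
  row' (psi a) (split_mx C *m X) = 0 ->
  h *m X = 0 /\ row' a ((C - s *: (c^T *m c)) *m rowsub psi X) = 0.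
Proof.
move=> /row'_eq0P AX.
have {}AX x l : x != psi a -> (split_mx C *m X) x l = 0.
  by move=> /AX/rowP/(_ l); rewrite !mxE.
have hX : h *m X = 0.
  apply/rowP => l; have := AX u l; rewrite eq_sym psi_neq split_mx_mul.
  rewrite mxE tr_restr_mx_mul_u add0r [_ u l]mxE tr_elim_row_mul_u => /(_ isT).
  by move/eqP; rewrite mulf_eq0 invr_eq0 (negPf s_neq0) => /eqP ->; rewrite mxE.
split=> //; apply/row'_eq0P => b ba; apply/rowP => l.
have := AX (psi b) l; rewrite (inj_eq psi_inj) split_mx_mul hX mulmx0 scaler0.
by rewrite addr0 tr_restr_mx_mul_psi => /(_ ba) BX0; rewrite [LHS]mxE BX0 mxE.
Qed.

Lemma mul_elim_rowE p (X : 'M[F]_(m, p)) :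
  h *m X = row u X - row (psi w) X + s *: (c *m rowsub psi X).
Proof.
by rewrite mulmxDl mulmxBl -!rowE -scalemxAl -mulmxA restr_mxE.
Qed.

Lemma elim_row_ker_psi (X : 'M[F]_m) b : h *m X = 0 ->
  X (psi w) (psi b) = X u (psi b) + s * (c *m mxsub psi psi X) 0 b.
Proof.
move=> /matrixP/(_ 0 (psi b)); rewrite mul_elim_rowE.
rewrite [mxsub psi psi X]mxsubcr mulmx_colsub; move: (c *m _) => y.
by rewrite !mxE addrAC => /subr0_eq <-.
Qed.

Lemma split_eq0 (X : 'M[F]_m) :
  X^T = X -> X u u = 0 -> h *m X = 0 -> mxsub psi psi X = 0 -> X = 0.
Proof.
move=> X_sym Xuu hX Y0.
have X_psi a b : X (psi a) (psi b) = 0.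
  by have /matrixP/(_ a b) := Y0; rewrite !mxE.
have X_u b : X u (psi b) = 0.
  have := elim_row_ker_psi b hX.
  by rewrite Y0 mulmx0 mxE mulr0 addr0 X_psi => <-.
apply: split_rowP; apply/matrixP => a x; rewrite !mxE;
  have [->//|/psi_onto[b ->]] := eqVneq x u; [|exact: X_psi|exact: X_u].
by rewrite -X_sym mxE X_u.
Qed.

Lemma split_mxE C x y : split_mx C x y =
  (Q^T *m C *m Q) x y + d 0 x * (c *m Q) 0 y + (c *m Q) 0 x * d 0 y
  + s^-1 * (d 0 x * d 0 y).
Proof.
rewrite /split_mx; move: (_ *m C *m Q) (c *m Q) d => Z y' x'.
by rewrite !mxE !big_ord1 !mxE.
Qed.

Lemma split_mx_psi C a b : split_mx C (psi a) (psi b) =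
  C a b - (a == w)%:R * c 0 b - c 0 a * (b == w)%:R
  + s^-1 * ((a == w)%:R * (b == w)%:R).
Proof.
rewrite split_mxE -mulmxA tr_restr_mx_mul_psi !mul_restr_mx_psi !edge_row_psi.
ring.
Qed.

Lemma split_mx_u C b : split_mx C u (psi b) = c 0 b - s^-1 * (b == w)%:R.
Proof.
rewrite split_mxE -mulmxA tr_restr_mx_mul_u mul_restr_mx_u !mul_restr_mx_psi.
rewrite edge_row_u edge_row_psi; ring.
Qed.

Lemma tr_split_mx C : C^T = C -> (split_mx C)^T = split_mx C.
Proof.
move=> C_sym; apply/matrixP => x y; rewrite mxE !split_mxE.
have QCQ_sym : (Q^T *m C *m Q)^T = Q^T *m C *m Q.
  by rewrite !trmx_mul trmxK C_sym mulmxA.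
by rewrite -[in LHS]QCQ_sym [_^T y x]mxE; ring.
Qed.

End SplitMatrix.
End VertexSplit.

Lemma nullity_pair_split (R : realType) m n (u : 'I_m) (w : 'I_n)
    (psi : 'I_n -> 'I_m) (s : R) (c : 'rV[R]_n) (C : 'M[R]_n) i :
  injective psi -> (forall a, psi a != u) ->
  (forall x, x != u -> exists a, x = psi a) -> s != 0 ->
  nullity_pair (psi i) (split_mx u w psi s c C)
    = nullity_pair i (C - s *: (c^T *m c)).
Proof.
move=> psi_inj psi_neq psi_onto s_neq0.
rewrite (split_mx_congr _ _ _ _ s_neq0).
rewrite (@nullity_pair_congr _ _ _ (lshift 1 i) _ _ _
  (split_frame_inv u w psi s c)).
- by apply: nullity_pair_block; rewrite unitmxE det_scalar1 unitfE invr_eq0.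
- exact: split_frameK.
- exact: split_frame_invK.
by rewrite rowKu; apply/rowP => x; rewrite !mxE eqxx eq_sym.
Qed.

Section RestrictRow.
Variables (R : pzRingType) (n : nat) (nu : pred 'I_n) (w : 'I_n).
Implicit Type C : 'M[R]_n.

Definition restrict_row C : 'rV[R]_n := \row_b (if nu b then C w b else 0).

Lemma restrict_row_linear : linear restrict_row.
Proof.
move=> c C D; apply/rowP => b; rewrite !mxE.
by case: (nu b); rewrite // mulr0 addr0.
Qed.

HB.instance Definition _ :=
  GRing.isLinear.Build R 'M[R]_n 'rV[R]_n *:%R restrict_row restrict_row_linear.

End RestrictRow.

(* [psi w] is the end of the contracted edge other than [u]. *)
Record is_splitting m n (H : sgraph m) (u : 'I_m) (G : sgraph n) (w : 'I_n)
    (psi : 'I_n -> 'I_m) : Prop := IsSplitting {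
  splitting_inj : injective psi;
  splitting_neq : forall a, psi a != u;
  splitting_onto : forall x, x != u -> exists a, x = psi a;
  splitting_edge_uw : edge H u (psi w);
  splitting_edge : forall a b, a != w -> b != w ->
    edge G a b = edge H (psi a) (psi b);
  splitting_edge_w : forall b, b != w ->
    edge G w b = edge H u (psi b) || edge H (psi w) (psi b) }.

Section SplittingPattern.
Variables (R : realType) (m n : nat) (H : sgraph m) (u : 'I_m).
Variables (G : sgraph n) (w : 'I_n) (psi : 'I_n -> 'I_m).
Hypothesis HG : is_splitting H u G w psi.

Let psi_inj := splitting_inj HG.
Let psi_neq := splitting_neq HG.
Let psi_onto := splitting_onto HG.

Definition u_nbr : pred 'I_n := fun b => (b != w) && edge H u (psi b).

Section Pattern.
Hypothesis no_common : forall x, ~~ (edge H u x && edge H (psi w) x).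
Variables (s : R) (C : 'M[R]_n).
Hypotheses (s_neq0 : s != 0) (C_in : in_S G C).
Local Notation c := (restrict_row u_nbr w C).
Local Notation A' := (split_mx u w psi s c C).

Let C_sym : C^T = C.
Proof. by have [] := C_in. Qed.

Let C_edge a b : a != b -> (C a b != 0) = edge G a b.
Proof. by have /in_SP[_] := C_in; apply. Qed.

Lemma split_mx_edge_u b : (A' u (psi b) != 0) = edge H u (psi b).
Proof.
rewrite (split_mx_u w psi_inj psi_neq) mxE /u_nbr; have [->|bw] := eqVneq b w.
  by rewrite (splitting_edge_uw HG) mulr1 sub0r oppr_eq0 invr_eq0.
rewrite mulr0 subr0 /=; case: ifP => [ub|]; last by rewrite eqxx.
by rewrite C_edge 1?eq_sym // (splitting_edge_w HG bw) ub.
Qed.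

Lemma split_mx_edge_w b : b != w ->
  (A' (psi w) (psi b) != 0) = edge H (psi w) (psi b).
Proof.
move=> bw; rewrite (split_mx_psi w psi_inj psi_neq) !mxE /u_nbr eqxx.
rewrite (negPf bw) /= !mulr0 mul1r subr0 addr0.
have := no_common (psi b); case: ifP => [ub|/negbT ub] /=.
  by rewrite subrr eqxx => /negPf.
by rewrite subr0 C_edge 1?eq_sym // (splitting_edge_w HG bw) (negPf ub).
Qed.

Lemma in_S_split : in_S H A'.
Proof.
have A'_sym : A'^T = A' by apply: tr_split_mx.
have edge_sym_of x y : (A' x y != 0) = edge H x y -> (A' y x != 0) = edge H y x.
  by move=> A'_edge; rewrite -A'_sym [_^T y x]mxE A'_edge edge_sym.
apply/in_SP; split=> // x y xy.
have [xu|/psi_onto[a xa]] := eqVneq x u;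
  have [yu|/psi_onto[b yb]] := eqVneq y u.
- by rewrite xu yu eqxx in xy.
- by rewrite xu yb split_mx_edge_u.
- by rewrite xa yu; apply/edge_sym_of/split_mx_edge_u.
have ab : a != b by rewrite -(inj_eq psi_inj) -xa -yb.
rewrite xa yb; have [aw|aw] := eqVneq a w.
  by rewrite aw split_mx_edge_w // -aw eq_sym.
have [bw|bw] := eqVneq b w.
  by rewrite bw; apply/edge_sym_of/split_mx_edge_w.
rewrite (split_mx_psi w psi_inj psi_neq) (negPf aw) (negPf bw).
by rewrite !(mul0r, mulr0, subr0, addr0) C_edge // (splitting_edge HG).
Qed.

End Pattern.

Lemma norm_pattern_part_split (s : R) (c : 'rV[R]_n) (X : 'M[R]_m) :
  0 < s -> X^T = X -> pattern_part H X = 0 -> elim_row u w psi s c *m X = 0 ->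
  `|pattern_part G (mxsub psi psi X)| <= s * `|c *m mxsub psi psi X|.
Proof.
move=> s_gt0 X_sym X0 hX; set Y := mxsub psi psi X.
have bound_ge0 : 0 <= s * `|c *m Y| by rewrite mulr_ge0 // ltW.
have X_edge := (pattern_part_eq0P _ _).1 X0.
have Y_w b : b != w -> edge G w b -> `|Y w b| <= s * `|c *m Y|.
  move=> bw; rewrite (splitting_edge_w HG bw) => /orP[ub|wb]; last first.
    by rewrite mxE X_edge ?wb ?orbT ?normr0.
  rewrite mxE (elim_row_ker_psi b hX) X_edge ?ub ?orbT // add0r.
  by rewrite normrM gtr0_norm // ler_wpM2l ?mx_norm_entry // ltW.
have Y_sym : Y^T = Y by apply/matrixP => a b; rewrite !mxE -[in LHS]X_sym mxE.
apply: mx_norm_le => // a b; rewrite mxE.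
have [->|ab /=] := eqVneq a b; first by rewrite mxE X_edge ?eqxx ?normr0.
case: ifP => [Gab|_]; last by rewrite normr0.
have [aw|aw] := eqVneq a w; first by rewrite aw Y_w // -aw // eq_sym.
have [bw|bw] := eqVneq b w.
  by rewrite bw -[in leLHS]Y_sym [_^T a w]mxE Y_w // -bw edge_sym.
rewrite (splitting_edge HG aw bw) in Gab.
by rewrite mxE X_edge ?normr0 // Gab orbT.
Qed.

Lemma SNIP_split (s : R) (c : 'rV[R]_n) (C : 'M[R]_n) (i : 'I_n) :
  0 < s -> in_S H (split_mx u w psi s c C) ->
  relaxed_SNIP G i s c C ->
  SNIP (psi i) (split_mx u w psi s c C).
Proof.
move=> s_gt0 A'_in relaxed; have s_neq0 : s != 0 by rewrite gt_eqF.
apply/(SNIPP _ A'_in) => X X_sym X0 A'X.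
have [hX BX] := split_mx_ker psi_inj psi_neq s_neq0 A'X.
apply: (split_eq0 psi_onto X_sym _ hX).
  by move/pattern_part_eq0P: X0; apply; rewrite eqxx.
apply: relaxed; first 1 last.
- exact: norm_pattern_part_split.
- rewrite row'_mul mxsubcr mulmx_colsub -row'_mul BX.
  by apply/matrixP => a b; rewrite !mxE.
by apply/matrixP => a b; rewrite !mxE -[in LHS]X_sym mxE.
Qed.

End SplittingPattern.

Lemma splitting_SNIP_lift (R : realType) m n (H : sgraph m) (u : 'I_m)
    (G : sgraph n) (w : 'I_n) (psi : 'I_n -> 'I_m) (i : 'I_n) (A : 'M[R]_n) :
  is_splitting H u G w psi ->
  (forall x, ~~ (edge H u x && edge H (psi w) x)) ->
  in_S G A -> SNIP i A ->
  exists A' : 'M[R]_m,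
    [/\ in_S H A', nullity_pair (psi i) A' = nullity_pair i A
      & SNIP (psi i) A'].
Proof.
move=> HG no_common A_in snipA.
have [s [C [s_gt0 C_in relaxed null_B]]] :=
  SNIP_rank1_perturbation (restrict_row (u_nbr H u w psi) w) A_in snipA.
have s_neq0 : s != 0 by rewrite gt_eqF.
have [psi_inj psi_neq psi_onto _ _ _] := HG.
have A'_in := in_S_split HG no_common s_neq0 C_in.
exists (split_mx u w psi s (restrict_row (u_nbr H u w psi) w C) C).
split=> //; first by rewrite nullity_pair_split.
by apply: (SNIP_split HG).
Qed.

Section Contraction.
Variables (m n : nat) (H : sgraph m) (u v : 'I_m).
Variables (G : sgraph n) (w : 'I_n) (phi : 'I_m -> 'I_n).
Hypothesis hG : is_contraction H u v G w phi.

Lemma contraction_uv_neq : v != u.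
Proof.
by apply: contraTneq (contr_edge hG) => ->; rewrite edge_irrefl.
Qed.

Lemma contraction_swap : is_contraction H v u G w phi.
Proof.
case: hG => huv onto phi_u phi_v fibre inj adj; split=> //.
  by rewrite edge_sym.
by move=> x /fibre [->|->]; [right | left].
Qed.

Lemma contraction_section : exists psi : 'I_n -> 'I_m,
  [/\ cancel psi phi, forall a, psi a != u,
      forall x, x != u -> x = psi (phi x) & psi w = v].
Proof.
have [psi psiP] :
    {psi : 'I_n -> 'I_m & forall a, phi (psi a) = a /\ psi a != u}.
  apply: (@choice _ _ (fun a x => phi x = a /\ x != u)) => a.
  have [x xa] := contr_onto hG a.
  have [xu|xu] := eqVneq x u; last by exists x.
  exists v; split; last exact: contraction_uv_neq.
  by rewrite (contr_v hG) -xa xu (contr_u hG).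
have psiK : cancel psi phi by move=> a; have [] := psiP a.
have fibre_w x : x != u -> phi x = w -> x = v.
  by move=> xu /(contr_fibre_w hG) [E|//]; rewrite E eqxx in xu.
have psi_w : psi w = v by apply: fibre_w => //; have [] := psiP w.
exists psi; split=> // [a|x xu]; first by have [] := psiP a.
have [xw|/eqP xw] := eqVneq (phi x) w.
  by rewrite xw psi_w; apply: fibre_w.
by apply: (contr_inj hG xw); rewrite psiK.
Qed.

Lemma contraction_splitting : exists2 psi : 'I_n -> 'I_m,
  is_splitting H u G w psi /\ psi w = v & forall x, x != u -> x = psi (phi x).
Proof.
have [psi [psiK psi_neq phiK psi_w]] := contraction_section.
exists psi => //; split=> //.
have psi_fibre a x : a != w -> phi x = a -> x = psi a.
  move=> aw xa; apply: (contr_inj hG); last by rewrite psiK.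
  by rewrite xa; apply/eqP.
split=> //.
- exact: can_inj psiK.
- by move=> x xu; exists (phi x); apply: phiK.
- by rewrite psi_w (contr_edge hG).
- move=> a b aw bw; apply/idP/idP => [/(contr_adj hG)[_ [x [y [xa yb]]]]|ab].
    by rewrite (psi_fibre a x) // (psi_fibre b y).
  apply/(contr_adj hG); split; last by exists (psi a), (psi b); rewrite !psiK.
  by move=> E; rewrite E edge_irrefl in ab.
move=> b bw; apply/idP/idP.
  move=> /(contr_adj hG)[_ [x [y [xw yb xy]]]].
  rewrite psi_w -(psi_fibre b y) //.
  by have [<-|<-] := contr_fibre_w hG xw; rewrite xy ?orbT.
move=> uvb; apply/(contr_adj hG); split; first by apply/eqP; rewrite eq_sym.
case/orP: uvb => [ub|vb]; last by exists (psi w), (psi b); rewrite !psiK.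
by exists u, (psi b); rewrite (contr_u hG) psiK.
Qed.

End Contraction.

(* [phi j = i] says that j is the vertex i itself when i <> w, and that j is
   either one of u and v when i = w. *)
Theorem lemma6p10 (R : realType) (m n : nat) (H : sgraph m) (u v : 'I_m)
  (huv : edge H u v)
  (hcommon : forall x : 'I_m, ~ (edge H u x /\ edge H v x))
  (G : sgraph n) (w : 'I_n) (phi : 'I_m -> 'I_n)
  (hG : is_contraction H u v G w phi)
  (i : 'I_n) (A : 'M[R]_n) (hA : in_S G A) (hSNIP : SNIP i A)
  (j : 'I_m) (hj : phi j = i) :
  exists A' : 'M[R]_m,
    [/\ in_S H A', nullity_pair j A' = nullity_pair i A & SNIP j A'].
Proof.
wlog ju : u v huv hcommon hG / j != u.
  move=> lift_neq; have [ju|] := eqVneq j u; last exact: (lift_neq u v).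
  apply: (lift_neq v u) => [|x [vx ux]||].
  - by rewrite edge_sym.
  - exact: (hcommon x).
  - exact: contraction_swap.
  by rewrite ju eq_sym (contraction_uv_neq hG).
have [psi [HG psi_w] phiK] := contraction_splitting hG.
have -> : j = psi i by rewrite -hj; apply: phiK.
apply: (splitting_SNIP_lift HG) => // x; rewrite psi_w.
by apply/negP => /andP[ux vx]; apply: (hcommon x).
Qed.
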